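(* Let $\{p_i\}_{i=1}^\infty$ be a sequence of pairwise distinct points of $\mathcal{M}$ such that $\mathrm{Cl}(\{p_i\}_{i=1}^\infty)$ is somewhere dense (i.e. has non-empty interior), and for every $i\in\mathbb{N}$ let $\{\rho^i_n\}_{n=1}^\infty$ be any decreasing sequence of positive reals with $\lim_{n\to\infty}\rho^i_n=0$. Then the open dynamical system $(\mathcal{M},d,f,\mathfrak{S})$ with $\mathfrak{S}=\{p_i,\{\rho^i_n\}: i\in\mathbb{N},n\in\mathbb{N}\}$ is not completely indecisive, i.e. the set $\mathfrak{T}$ is not residual in $\mathcal{M}$.
   Context: Throughout, $(\mathcal{M},d)$ is a compact metric space with no isolated points and $f:\mathcal{M}\to\mathcal{M}$ is a homeomorphism. $\mathbb{N}$ is the set of positive integers, $\mathbb{N}_0=\mathbb{N}\cup\{0\}$. $B^i_n=B_{\rho^i_n}(p_i)$ is the open ball of radius $\rho^i_n$ about $p_i$. ''Decreasing'' means $\rho^i_{n+1}<\rho^i_n$ for all $n$. With the convention $\min\emptyset=+\infty$, for $i\in\mathbb{N}$ the set $\mathfrak{T}(i)$ consists of the $x\in\mathcal{M}$ such that for infinitely many $n\in\mathbb{N}$, $\min\{k\in\mathbb{N}_0:f^k(x)\in B^i_n\}<\min\{k\in\mathbb{N}_0:f^k(x)\in B^j_n\}$ for all $j\neq i$. $\mathfrak{T}=\bigcap_{i=1}^\infty\mathfrak{T}(i)$. The open dynamical system is completely indecisive if $\mathfrak{T}$ is residual, i.e. $\mathcal{M}\setminus\mathfrak{T}$ is a countable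 union of nowhere dense sets. *)

(* Defs.v *)
From HB Require Import structures.
From mathcomp Require Import all_boot all_order all_algebra.
From mathcomp Require Import all_classical all_reals all_analysis.
Import Order.TTheory GRing.Theory Num.Theory.
Import numFieldNormedType.Exports.

Set Implicit Arguments.
Unset Strict Implicit.
Unset Printing Implicit Defensive.

Local Open Scope classical_set_scope.
Local Open Scope ring_scope.

Definition homeomorphism (T U : topologicalType) (f : T -> U) : Prop :=
  exists g : U -> T,
    [/\ cancel f g, cancel g f, continuous f & continuous g].

Definition nowhere_dense (T : topologicalType) (A : set T) : Prop :=
  interior (closure A) = set0.

(* Finite unions are covered, since set0 is nowhere dense. *)
Definition residual (T : topologicalType) (A : set T) : Prop :=
  exists F : nat -> set T,
    (forall n, nowhere_dense (F n)) /\ ~` A = \bigcup_n F n.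

(* Convention: min set0 = +oo. *)
Definition min_nat (R : realType) (A : set nat) : \bar R :=
  match pselect (exists k, k \in A) with
  | left exA => (ex_minn exA)%:R%:E
  | right _ => +oo%E
  end.

Definition hitting_time (R : realType) (M : Type) (f : M -> M) (B : set M)
    (x : M) : \bar R :=
  min_nat R [set k | B (iter k f x)].

(* Both the holes and the radii are indexed from 0 instead of 1; the hole
   B^i_n is ball (p i) (rho i n). *)
Definition indecisive_at (R : realType) (M : metricType R) (f : M -> M)
    (p : nat -> M) (rho : nat -> nat -> R) (i : nat) : set M :=
  [set x | infinite_set [set n | forall j, j <> i ->
    (hitting_time R f (ball (p i) (rho i n)) x
       < hitting_time R f (ball (p j) (rho j n)) x)%E]].

Definition indecisive_set (R : realType) (M : metricType R) (f : M -> M)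
    (p : nat -> M) (rho : nat -> nat -> R) : set M :=
  \bigcap_i indecisive_at f p rho i.

Definition completely_indecisive (R : realType) (M : metricType R)
    (f : M -> M) (p : nat -> M) (rho : nat -> nat -> R) : Prop :=
  residual (indecisive_set f p rho).

(* Main.v *)
Require Import Defs.
From HB Require Import structures.
From mathcomp Require Import all_boot all_order all_algebra.
From mathcomp Require Import all_classical all_reals all_analysis.
Import Order.TTheory GRing.Theory Num.Theory.
Import numFieldNormedType.Exports.

Set Implicit Arguments.
Unset Strict Implicit.
Unset Printing Implicit Defensive.

Local Open Scope classical_set_scope.
Local Open Scope ring_scope.

(** A point that already lies in a hole has hitting time 0 for it, and nothing
    is strictly smaller than 0.  So a point is never claimed by hole 0 at level
    [n] if it lies in some hole [j != 0] of level [n].  Let [U] be the interior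
    of the closure of the centres.  As there are no isolated points, the centres
    [p j] with [j != 0] are still dense in [U] ([dense_range_avoid]), so the
    union of the level-[n] holes around them fills [U] up to a nowhere dense set
    ([nowhere_dense_gap]).  Hence the points of [U] that are claimed by hole 0
    at even one level form a meagre set.  If the indecisive set were residual,
    the nonempty open set [U] would be covered by countably many nowhere dense
    sets, against the Baire category theorem ([compact_baire]). *)

(** The form of nowhere density that iterates: shrinking an open set to avoid
    [A] and then shrinking the result to avoid [B] avoids both. *)
Lemma nowhere_denseP (T : topologicalType) (A : set T) :
  nowhere_dense A <->
  forall O, open O -> O !=set0 ->
    exists V, [/\ open V, V !=set0, V `<=` O & V `&` A = set0].
Proof.
split=> [A0 O oO [x Ox]|H].
- exists (O `\` closure A); split.
  + by apply: openI => //; exact/closed_openC/closed_closure.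
  + apply: contrapT => /nonemptyPn; rewrite setD_eq0 => OA.
    have : interior (closure A) x by apply: filterS OA _; exact: open_nbhs_nbhs.
    by rewrite A0.
  + exact: subDsetl.
  + by rewrite -subset0 => y [[_ nAy] Ay]; apply/nAy/subset_closure.
- apply: contrapT => /eqP/set0P A0.
  have [V [oV [y Vy] sub VA]] := H _ (@open_interior _ (closure A)) A0.
  have [|z [Az Vz]] := interior_subset (sub _ Vy) V.
    exact: open_nbhs_nbhs.
  by have : (V `&` A) z by []; rewrite VA.
Qed.

Lemma nowhere_denseU (T : topologicalType) (A B : set T) :
  nowhere_dense A -> nowhere_dense B -> nowhere_dense (A `|` B).
Proof.
move=> /nowhere_denseP HA /nowhere_denseP HB; apply/nowhere_denseP => O oO O0.
have [V1 [oV1 V10 V1O V1A]] := HA O oO O0.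
have [V2 [oV2 V20 V2O V2B]] := HB V1 oV1 V10.
exists V2; split => //; first exact: subset_trans V1O.
rewrite setIUr V2B setU0 -subset0 -V1A; exact: setSI.
Qed.

(** Baire category theorem for compact Hausdorff spaces.  Regularity lets one
    choose nonempty open sets [V 0, V 1, ...] such that the closure of
    [V n.+1] lies in [V n] and misses [F n]; compactness gives a point
    common to all the closures, which no [F n] can contain. *)
Lemma compact_baire (T : topologicalType) (F : nat -> set T) (O : set T) :
  hausdorff_space T -> compact [set: T] ->
  (forall n, nowhere_dense (F n)) -> open O -> O !=set0 ->
  ~ O `<=` \bigcup_n F n.
Proof.
move=> hT cT F0 oO O0 OF.
(* Totalised over all pairs, so that [choice] yields a plain function; pairs with
   a bad second component never occur in the iteration. *)
have step (q : nat * set T) : exists V, open q.2 -> q.2 !=set0 ->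
    [/\ open V, V !=set0 & closure V `<=` q.2 `\` F q.1].
  case: q => n W /=; have [[oW W0]|nW] := pselect (open W /\ W !=set0); last first.
    by exists W => oW W0; exfalso; exact: nW.
  have [X [oX [x Xx] XW XF]] := (nowhere_denseP _).1 (F0 n) W oW W0.
  have [] := compact_regular hT cT (x := x) _ (t := X).
  - exact: filterT.
  - exact: open_nbhs_nbhs.
  move=> V xV clV; exists (interior V) => _ _; split.
  - exact: open_interior.
  - by exists x.
  - move=> y /(closure_subset (@interior_subset _ V)) /clV Xy.
    split; first exact: XW.
    by move=> Fy; have : (X `&` F n) y by []; rewrite XF.
have [g Hg] := choice step.
pose V := fix V n := if n is m.+1 then g (m, V m) else O.
have V_ok n : open (V n) /\ V n !=set0.
  by elim: n => [//|n [oV V0]] /=; have [] := Hg (n, V n) oV V0.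
have clV n : closure (V n.+1) `<=` V n `\` F n.
  by have [oV V0] := V_ok n; have [] := Hg (n, V n) oV V0.
have V_anti n : V n.+1 `<=` V n.
  by move=> y /subset_closure /clV [].
have V_decr m n : (m <= n)%N -> V n `<=` V m.
  elim: n => [|n IH]; first by rewrite leqn0 => /eqP ->.
  rewrite leq_eqVlt => /predU1P[-> //|mn].
  exact: subset_trans (V_anti n) (IH mn).
pose G := filter_from [set: nat] V.
have GP : ProperFilter G.
  apply: filter_from_proper; last by move=> n _; have [] := V_ok n.
  apply: filter_from_filter; first by exists 0%N.
  move=> m n _ _; exists (maxn m n) => // y Vy; split.
  - exact: V_decr (leq_maxl _ _) _ Vy.
  - exact: V_decr (leq_maxr _ _) _ Vy.
have [|x [_ Gx]] := cT G GP; first by exists 0%N.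
have xV n : closure (V n) x by move: Gx; rewrite clusterE; apply; exists n.
have [Ox _] := clV 0%N _ (xV 1%N).
have [n _ Fx] := OF x Ox.
by have [_] := clV n _ (xV n.+1); apply.
Qed.

(** Removing the single point [p i] from [O] leaves a nonempty open set, because
    points are closed and [p i] is not isolated. *)
Lemma dense_range_avoid (T : topologicalType) (I : Type) (p : I -> T) (i : I)
    (O : set T) :
  accessible_space T -> isolated [set: T] = set0 -> open O -> O !=set0 ->
  O `<=` closure (range p) -> exists2 j, j <> i & O (p j).
Proof.
move=> T1 noiso oO [x Ox] Ocl.
have oOi : open (O `\` [set p i]).
  by apply: openI => //; exact/closed_openC/accessible_closed_set1.
have [y Oiy] : O `\` [set p i] !=set0.
  apply: contrapT => /nonemptyPn; rewrite setD_eq0 => Oi.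
  have : isolated [set: T] x.
    split; first by rewrite in_setT.
    exists O; first exact: open_nbhs_nbhs.
    rewrite setIT; apply/seteqP; split=> [z /Oi ->|z ->//].
    by rewrite (Oi _ Ox).
  by rewrite noiso.
have [|_ [[j _ <-] [Oj ji]]] := Ocl y Oiy.1 (O `\` [set p i]).
  exact: open_nbhs_nbhs.
by exists j => // ij; apply: ji; rewrite ij.
Qed.

(** A nonempty open [O] either misses [U] or contains inside [U] some centre
    [p j] with [j <> i]; around that centre, [O] contains an open set included
    in one of the removed balls. *)
Lemma nowhere_dense_gap (R : realType) (M : metricType R) (p : nat -> M)
    (r : nat -> R) (i : nat) (U : set M) :
  isolated [set: M] = set0 -> open U -> U `<=` closure (range p) ->
  (forall j, 0 < r j) ->
  nowhere_dense (U `\` \bigcup_(j in [set j | j <> i]) ball (p j) (r j)).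
Proof.
move=> noiso oU Ucl r0; apply/nowhere_denseP => O oO O0.
have [OU0|OU0] := eqVneq (O `&` U) set0.
  by exists O; split => //; rewrite setIDA OU0 set0D.
have [||||j ji [Oj Uj]] := @dense_range_avoid M nat p i (O `&` U) _ noiso.
- exact/hausdorff_accessible/metric_hausdorff.
- exact: openI.
- exact/set0P.
- by move=> y [_ /Ucl].
exists (O `&` interior (ball (p j) (r j))); split.
- by apply: openI => //; exact: open_interior.
- by exists (p j); split => //; exact: nbhsx_ballx.
- exact: subIsetl.
- rewrite -subset0 => y [[_ /interior_subset yB] [_]]; apply.
  by exists j.
Qed.

Lemma hitting_time_ge0 (R : realType) (M : Type) (f : M -> M) (B : set M)
    (x : M) : (0 <= hitting_time R f B x)%E.
Proof.
by rewrite /hitting_time /min_nat; case: pselect => // k; rewrite lee_fin.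
Qed.

Lemma hitting_time_in (R : realType) (M : Type) (f : M -> M) (B : set M)
    (x : M) : B x -> hitting_time R f B x = 0%E.
Proof.
move=> Bx; have H0 : 0%N \in [set k | B (iter k f x)] by rewrite inE.
rewrite /hitting_time /min_nat; case: pselect => [ex|[]]; last by exists 0%N.
by case: ex_minnP => m _ /(_ _ H0); rewrite leqn0 => /eqP ->.
Qed.

(** At every level [n] some competitor [j] attains the minimal value 0. *)
Lemma not_indecisive_at (R : realType) (M : metricType R) (f : M -> M)
    (p : nat -> M) (rho : nat -> nat -> R) (i : nat) (x : M) :
  (forall n, exists2 j, j <> i & ball (p j) (rho j n) x) ->
  ~ indecisive_at f p rho i x.
Proof.
move=> H /infinite_setN0[n Hn]; have [j ji xj] := H n.
have := Hn j ji; rewrite (hitting_time_in R f xj) ltNge.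
by rewrite hitting_time_ge0.
Qed.

Theorem lemma20 (R : realType) (M : metricType R) (f : M -> M)
    (p : nat -> M) (rho : nat -> nat -> R)
    (M_compact : compact [set: M])
    (M_no_isolated : isolated [set: M] = set0)
    (f_homeo : homeomorphism f)
    (p_inj : injective p)
    (p_somewhere_dense : interior (closure (range p)) !=set0)
    (rho_gt0 : forall i n, 0 < rho i n)
    (rho_decreasing : forall i n, rho i n.+1 < rho i n)
    (rho_cvg0 : forall i, rho i n @[n --> \oo] --> (0 : R)) :
  ~ completely_indecisive f p rho.
Proof.
move=> [F [F_nd TF]].
set U := interior (closure (range p)).
pose gap n := U `\` \bigcup_(j in [set j | j <> 0%N]) ball (p j) (rho j n).
have gap_nd n : nowhere_dense (gap n).
  apply: nowhere_dense_gap => //; first exact: open_interior.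
  exact: interior_subset.
apply: (@compact_baire M (fun n => F n `|` gap n) U) => //.
- exact: metric_hausdorff.
- by move=> n; exact: nowhere_denseU.
- exact: open_interior.
move=> x Ux; apply: contrapT => xN.
have Tx : indecisive_set f p rho x.
  apply: contrapT => nTx; have : (~` indecisive_set f p rho) x by [].
  by rewrite TF => -[n _ Fx]; apply: xN; exists n => //; left.
apply: (not_indecisive_at (i := 0%N) (x := x) _ (Tx 0%N I)) => n.
apply: contrapT => Nx; apply: xN; exists n => //; right; split => //.
Qed.
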